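(* For every prime $p\ge 5$ and every integer $g\ge 2$, there exist a finite extension $K$ of the rational function field $\mathbb{F}_p(x,y)$ in two variables and a faithful (i.e. injective) representation $\Sigma_g\to \mathrm{PGL}_2(K)$.
   Context: $\Sigma_g$ denotes the fundamental group of a closed oriented surface of genus $g$. *)

(* Defs.v *)
From HB Require Import structures.
From mathcomp Require Import all_boot all_order all_algebra all_field.
From mathcomp Require Import generic_quotient boolp.

Set Implicit Arguments.
Unset Strict Implicit.
Unset Printing Implicit Defensive.

Import GRing.Theory.

Local Open Scope quotient_scope.

(* The letter (x, true) stands for the generator x, the letter (x, false) for
   its formal inverse. *)
Definition word (X : Type) : Type := seq (X * bool).

HB.instance Definition _ (X : choiceType) := Choice.on (word X).

Definition word_inv (X : Type) (w : word X) : word X :=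
  rev [seq (l.1, ~~ l.2) | l <- w].

(* u and v represent the same element of < X | R >. *)
Inductive word_eq (X : Type) (R : word X -> Prop) : word X -> word X -> Prop :=
| word_eq_refl u : word_eq R u u
| word_eq_sym u v : word_eq R u v -> word_eq R v u
| word_eq_trans v u w : word_eq R u v -> word_eq R v w -> word_eq R u w
| word_eq_free u x b v :
    word_eq R (u ++ [:: (x, b); (x, ~~ b)] ++ v) (u ++ v)
| word_eq_rel u r v : R r -> word_eq R (u ++ r ++ v) (u ++ v).

Section Presented.
Context (X : choiceType) (R : word X -> Prop).

Lemma word_eq_equiv : equiv_class_of (fun u v : word X => `[< word_eq R u v >]).
Proof.
split=> [u|u v|v u w].
- by apply/asboolP; constructor.
- by apply/asboolP/asboolP; apply: word_eq_sym.
- by move=> /asboolP uv /asboolP vw; apply/asboolP; apply: word_eq_trans vw.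
Qed.

Canonical word_eq_equiv_rel := EquivRelPack word_eq_equiv.

Definition presented_group : Type := {eq_quot word_eq_equiv_rel}.

HB.instance Definition _ := Choice.on presented_group.

Definition pg_class (w : word X) : presented_group :=
  \pi_({eq_quot word_eq_equiv_rel}) w.

Definition pg_repr (x : presented_group) : word X :=
  @repr _ {eq_quot word_eq_equiv_rel} x.

Lemma pg_reprK : cancel pg_repr pg_class.
Proof. exact: reprK. Qed.

Lemma pg_classP u v : pg_class u = pg_class v <-> word_eq R u v.
Proof.
split=> [/eqquotP/asboolP //|uv].
by apply/eqquotP/asboolP.
Qed.

Lemma pg_repr_class w : word_eq R (pg_repr (pg_class w)) w.
Proof. by apply/pg_classP; rewrite pg_reprK. Qed.

Lemma word_eq_cat2l w u v : word_eq R u v -> word_eq R (w ++ u) (w ++ v).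
Proof.
elim=> {u v} [u|u v _|v u t _ uv _ vt|u x b v|u r v Rr].
- exact: word_eq_refl.
- exact: word_eq_sym.
- exact: word_eq_trans vt.
- by rewrite !(catA w u); apply: word_eq_free.
- by rewrite !(catA w u); apply: word_eq_rel.
Qed.

Lemma word_eq_cat2r w u v : word_eq R u v -> word_eq R (u ++ w) (v ++ w).
Proof.
elim=> {u v} [u|u v _|v u t _ uv _ vt|u x b v|u r v Rr].
- exact: word_eq_refl.
- exact: word_eq_sym.
- exact: word_eq_trans vt.
- by rewrite -!catA; apply: word_eq_free.
- by rewrite -!catA; apply: word_eq_rel.
Qed.

Lemma word_eq_cat u u' v v' :
  word_eq R u u' -> word_eq R v v' -> word_eq R (u ++ v) (u' ++ v').
Proof.
move=> uu' vv'; apply: (word_eq_trans (word_eq_cat2r _ uu')).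
exact: word_eq_cat2l.
Qed.

Lemma word_eq_invl w : word_eq R (word_inv w ++ w) [::].
Proof.
elim: w => [|[x b] w IHw]; first exact: word_eq_refl.
apply: word_eq_trans IHw.
rewrite /word_inv /= rev_cons cat_rcons -/(word_inv w).
by have := word_eq_free R (word_inv w) x (~~ b) w; rewrite negbK.
Qed.

Lemma word_invK : involutive (@word_inv X).
Proof.
move=> w; rewrite /word_inv map_rev revK -map_comp -[RHS]map_id.
by apply: eq_map => -[x b] /=; rewrite negbK.
Qed.

Definition pg_one : presented_group := pg_class [::].
Definition pg_mul (x y : presented_group) : presented_group :=
  pg_class (pg_repr x ++ pg_repr y).
Definition pg_inv (x : presented_group) : presented_group :=
  pg_class (word_inv (pg_repr x)).

Lemma pg_classM u v : pg_class (u ++ v) = pg_mul (pg_class u) (pg_class v).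
Proof.
by apply/pg_classP/word_eq_sym/word_eq_cat; apply: pg_repr_class.
Qed.

Lemma pg_mulA : associative pg_mul.
Proof.
move=> x y z; rewrite -(pg_reprK x) -(pg_reprK y) -(pg_reprK z).
by rewrite -!pg_classM catA.
Qed.

Lemma pg_mul1 : left_id pg_one pg_mul.
Proof. by move=> x; rewrite -(pg_reprK x) -pg_classM. Qed.

Lemma pg_mulr1 : right_id pg_one pg_mul.
Proof. by move=> x; rewrite -(pg_reprK x) -pg_classM cats0. Qed.

Lemma pg_mulV : left_inverse pg_one pg_inv pg_mul.
Proof.
move=> x; apply/pg_classP; apply: word_eq_trans (word_eq_invl (pg_repr x)).
by apply: word_eq_cat2r; apply: pg_repr_class.
Qed.

Lemma pg_mulrV : right_inverse pg_one pg_inv pg_mul.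
Proof.
move=> x; apply/pg_classP.
apply: word_eq_trans (word_eq_invl (word_inv (pg_repr x))).
by rewrite word_invK; apply: word_eq_cat2l; apply: pg_repr_class.
Qed.

HB.instance Definition _ :=
  isGroup.Build presented_group pg_mulA pg_mul1 pg_mulr1 pg_mulV pg_mulrV.

End Presented.

(* The generators a_i = inl i and b_i = inr i, for i < g, are the standard
   loops on the 4g-gon whose boundary reads [a_0,b_0]...[a_{g-1},b_{g-1}],
   with [a,b] = a b a^-1 b^-1. *)
Definition surface_relator (g : nat) : word ('I_g + 'I_g) :=
  flatten [seq [:: (inl i, true); (inr i, true); (inl i, false); (inr i, false)]
          | i <- enum 'I_g].

(* The fundamental group of the closed oriented surface of genus g, through its
   one-relator presentation. *)
Definition surface_group (g : nat) : groupType :=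
  presented_group (fun w => w = surface_relator g).

Local Open Scope ring_scope.

Section ProjectiveLinear.
Context (n : nat) (K : fieldType).

Record gl : Type := GL { gl_val : 'M[K]_n; _ : gl_val \in unitmx }.

HB.instance Definition _ := [isSub for gl_val].
HB.instance Definition _ := [Choice of gl by <:].

Lemma gl_mul_subproof (A B : gl) : val A *m val B \in unitmx.
Proof. by rewrite unitmx_mul (valP A) (valP B). Qed.

Lemma gl_inv_subproof (A : gl) : invmx (val A) \in unitmx.
Proof. by rewrite unitmx_inv (valP A). Qed.

Definition gl_one : gl := GL (unitmx1 K n).
Definition gl_mul (A B : gl) : gl := GL (gl_mul_subproof A B).
Definition gl_inv (A : gl) : gl := GL (gl_inv_subproof A).

Lemma gl_mulA : associative gl_mul.
Proof. by move=> A B C; apply: val_inj; rewrite /= mulmxA. Qed.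

Lemma gl_mul1 : left_id gl_one gl_mul.
Proof. by move=> A; apply: val_inj; rewrite /= mul1mx. Qed.

Lemma gl_mulr1 : right_id gl_one gl_mul.
Proof. by move=> A; apply: val_inj; rewrite /= mulmx1. Qed.

Lemma gl_mulV : left_inverse gl_one gl_inv gl_mul.
Proof. by move=> A; apply: val_inj; rewrite /= mulVmx ?(valP A). Qed.

Lemma gl_mulrV : right_inverse gl_one gl_inv gl_mul.
Proof. by move=> A; apply: val_inj; rewrite /= mulmxV ?(valP A). Qed.

HB.instance Definition _ :=
  isGroup.Build gl gl_mulA gl_mul1 gl_mulr1 gl_mulV gl_mulrV.

Definition gl_scalar_eq (A B : gl) : bool :=
  `[< exists2 c : K, c != 0 & val A = c *: val B >].

Lemma gl_scalar_eq_equiv : equiv_class_of gl_scalar_eq.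
Proof.
have sym A B : gl_scalar_eq A B -> gl_scalar_eq B A.
  move=> /asboolP[c c0 AB]; apply/asboolP; exists c^-1; first by rewrite invr_eq0.
  by rewrite AB scalerA mulVf // scale1r.
split=> [A|A B|B A C].
- by apply/asboolP; exists 1; rewrite ?oner_eq0 // scale1r.
- by apply/idP/idP; apply: sym.
- move=> /asboolP[c c0 AB] /asboolP[d d0 BC]; apply/asboolP.
  by exists (c * d); rewrite ?mulf_neq0 // AB BC scalerA.
Qed.

Canonical gl_scalar_eq_equiv_rel := EquivRelPack gl_scalar_eq_equiv.

(* PGL_n(K) = GL_n(K) / K^*. *)
Definition pgl : Type := {eq_quot gl_scalar_eq_equiv_rel}.

HB.instance Definition _ := Choice.on pgl.

Definition pgl_class (A : gl) : pgl := \pi_({eq_quot gl_scalar_eq_equiv_rel}) A.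

Definition pgl_repr (x : pgl) : gl := @repr _ {eq_quot gl_scalar_eq_equiv_rel} x.

Lemma pgl_reprK : cancel pgl_repr pgl_class.
Proof. exact: reprK. Qed.

Lemma pgl_classP A B :
  pgl_class A = pgl_class B <-> exists2 c : K, c != 0 & val A = c *: val B.
Proof.
split=> [/eqquotP/asboolP //|AB].
by apply/eqquotP/asboolP.
Qed.

Definition pgl_one : pgl := pgl_class gl_one.
Definition pgl_mul (x y : pgl) : pgl := pgl_class (gl_mul (pgl_repr x) (pgl_repr y)).
Definition pgl_inv (x : pgl) : pgl := pgl_class (gl_inv (pgl_repr x)).

Lemma pgl_classM A B : pgl_class (gl_mul A B) = pgl_mul (pgl_class A) (pgl_class B).
Proof.
have /pgl_classP[c c0 Ac] := esym (pgl_reprK (pgl_class A)).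
have /pgl_classP[d d0 Bd] := esym (pgl_reprK (pgl_class B)).
apply/pgl_classP; exists (c * d); first by rewrite mulf_neq0.
by rewrite /= Ac Bd -scalemxAl -scalemxAr scalerA.
Qed.

Lemma pgl_mulA : associative pgl_mul.
Proof.
move=> x y z; rewrite -(pgl_reprK x) -(pgl_reprK y) -(pgl_reprK z).
by rewrite -!pgl_classM gl_mulA.
Qed.

Lemma pgl_mul1 : left_id pgl_one pgl_mul.
Proof. by move=> x; rewrite -(pgl_reprK x) -pgl_classM gl_mul1. Qed.

Lemma pgl_mulr1 : right_id pgl_one pgl_mul.
Proof. by move=> x; rewrite -(pgl_reprK x) -pgl_classM gl_mulr1. Qed.

Lemma pgl_mulV : left_inverse pgl_one pgl_inv pgl_mul.
Proof.
move=> x; rewrite /pgl_inv -[X in pgl_mul _ X]pgl_reprK.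
by rewrite -pgl_classM gl_mulV.
Qed.

Lemma pgl_mulrV : right_inverse pgl_one pgl_inv pgl_mul.
Proof.
move=> x; rewrite /pgl_inv -[X in pgl_mul X _]pgl_reprK.
by rewrite -pgl_classM gl_mulrV.
Qed.

HB.instance Definition _ :=
  isGroup.Build pgl pgl_mulA pgl_mul1 pgl_mulr1 pgl_mulV pgl_mulrV.

End ProjectiveLinear.

(* Main.v *)
From HB Require Import structures.
Require Import Defs.
From mathcomp Require Import all_boot all_order all_algebra all_field.
From mathcomp Require Import fraction mpoly.
From mathcomp Require Import zify ring.

(** Put n = g - 1, let F be a field and let
      Gamma = < a, b, t | t^2 = 1, t c t = c^-1 >, with c = [a, b],
    the orbifold group of the torus with two cone points of order 2. It is the
    free group on a and b amalgamated with the infinite dihedral group < t, c >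
    along < c >. The representation is a composite of two injective maps
    Sigma_g -> Gamma -> PGL_2(F(x, y)).

    The first map is a covering of orbifolds. The elements a, b, t a t and
    t b t of Gamma satisfy the relation of the genus 2 surface group, and the
    n-fold cyclic covering of that surface which unwinds the loop a has genus
    n + 1. This gives the images a^n and b of the first two generators of
    Sigma_g, and a^k t a t a^-k and a^k t b t a^-k (k < n) of the others;
    since t c t = [b, a], the surface relation reduces to the telescoping
    product of the a^k [b, a] a^-k, which is [b, a^n]. For injectivity
    ([cover_map_inj]), Gamma acts on 2 n copies of Sigma_g, one for each of
    the 2 n cosets of the image, in such a way that the image of w sends the
    point 1 of the base copy to w.

    The second map sends t to (0 y; 1 0), and a and b to matrices over F[x]
    whose commutator is diag(x^3, x^-3), which the conjugation by t inverts.
    It is faithful for the reason found by Shalen for representations of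
    amalgamated products: if no u_i in < a, b > has lower left entry 0, then
    u_1 t u_2 t ... t u_m is not scalar, because its lower left entry has
    degree m - 1 in y ([alternate_act], [normal_scalar]). Every element of
    Gamma has such a form, up to a factor t at each end, or lies in < c > or
    < c > t ([normal_form]), provided that each element of < a, b > with lower
    left entry 0, that is, fixing the point (1 : 0) of the projective line, is
    a power of c ([stabilizer_cycle]). For this last fact, a and b play
    ping-pong on the projective line for the degree in x ([pingpong]), and
    (1 : 0) is the end of the free group described by the periodic word
    c c c ...; an element fixing that end is a translation along the axis of
    c. *)

Set Implicit Arguments.
Unset Strict Implicit.
Unset Printing Implicit Defensive.

Import GRing.Theory.

Local Open Scope ring_scope.

(** * Homomorphisms out of presented groups *)

Section WordEval.
Local Open Scope group_scope.
Context (X : choiceType) (G : groupType) (f : X -> G).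

Definition letter_eval (l : X * bool) : G :=
  if l.2 then f l.1 else (f l.1)^-1.

Definition word_eval (w : word X) : G := \prod_(l <- w) letter_eval l.

Lemma word_eval_nil : word_eval [::] = 1.
Proof. exact: big_nil. Qed.

Lemma word_eval_cons l w : word_eval (l :: w) = letter_eval l * word_eval w.
Proof. exact: big_cons. Qed.

Lemma word_eval_cat u v : word_eval (u ++ v) = word_eval u * word_eval v.
Proof. exact: big_cat. Qed.

Lemma letter_eval_inv x b : letter_eval (x, b) * letter_eval (x, ~~ b) = 1.
Proof. by case: b; rewrite /letter_eval /= ?mulgV ?mulVg. Qed.

Lemma word_eval_eq (R : word X -> Prop) :
  (forall r, R r -> word_eval r = 1) ->
  forall u v, word_eq R u v -> word_eval u = word_eval v.
Proof.
move=> R1 u v; elim=> {u v} // [u v w _ -> _ //|u x b v|u r v Rr].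
  rewrite !word_eval_cat !word_eval_cons word_eval_nil mulg1 !mulgA.
  by rewrite -(mulgA _ (letter_eval (x, b))) letter_eval_inv mulg1.
by rewrite !word_eval_cat (R1 r Rr) mul1g.
Qed.

Lemma word_eval_inv w : word_eval (word_inv w) = (word_eval w)^-1.
Proof.
apply: (mulIg (word_eval w)); rewrite mulVg -word_eval_cat -word_eval_nil.
apply: (@word_eval_eq (fun=> False)) => //; exact: word_eq_invl.
Qed.

Context (R : word X -> Prop) (R1 : forall r, R r -> word_eval r = 1).

(** The universal property of the presentation: [pg_lift_class] and
    [pg_lift_mul] need the relators to be killed, the underlying map does not. *)
Definition pg_lift (x : presented_group R) : G := word_eval (pg_repr x).

Lemma pg_lift_class w : pg_lift (pg_class R w) = word_eval w.
Proof. exact/(word_eval_eq R1)/pg_repr_class. Qed.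

Lemma pg_lift_mul : {morph pg_lift : x y / x * y}.
Proof.
move=> x y; rewrite -(pg_reprK x) -(pg_reprK y) -[_ * _]/(pg_mul _ _).
by rewrite -pg_classM !pg_lift_class word_eval_cat.
Qed.

End WordEval.

Lemma pg_class_eval (X : choiceType) (R : word X -> Prop) w :
  pg_class R w = word_eval (fun x => pg_class R [:: (x, true)]) w.
Proof.
elim: w => [|[x b] w IH]; first by rewrite word_eval_nil.
rewrite word_eval_cons -IH -cat1s pg_classM; congr (_ * _)%g.
case: b => //=; rewrite /letter_eval /=; apply/esym/mulg1_eq.
rewrite -[(_ * _)%g]/(pg_mul _ _) -pg_classM.
exact/pg_classP/(word_eq_free R [::] x true [::]).
Qed.

Lemma pg_class_rel (X : choiceType) (R : word X -> Prop) r :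
  R r -> pg_class R r = 1%g.
Proof.
by move=> Rr; apply/pg_classP; have := word_eq_rel [::] [::] Rr; rewrite cats0.
Qed.

(** * The matrices of a, b and t *)

Section Matrices.
Context (D : comNzRingType).
Implicit Types (M N : 'M[D]_2) (v : D * D).

Definition mx2 (a b c d : D) : 'M[D]_2 :=
  \matrix_(i, j) if i == 0 then (if j == 0 then a else b)
                 else (if j == 0 then c else d).

Lemma mx2E a b c d :
  (mx2 a b c d 0 0 = a) * (mx2 a b c d 0 1 = b) *
  ((mx2 a b c d 1 0 = c) * (mx2 a b c d 1 1 = d)).
Proof. by rewrite !mxE. Qed.

Lemma mx2P M N : M 0 0 = N 0 0 -> M 0 1 = N 0 1 -> M 1 0 = N 1 0 ->
  M 1 1 = N 1 1 -> M = N.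
Proof.
have I2 (i : 'I_2) : i = 0 \/ i = 1.
  by case: i => [[|[|//]]] ?; [left | right]; apply/val_inj.
by move=> e00 e01 e10 e11; apply/matrixP=> i j; case: (I2 i) (I2 j) => -> [] ->.
Qed.

Lemma mulmx2E M N i j : (M * N) i j = M i 0 * N 0 j + M i 1 * N 1 j.
Proof.
rewrite mxE !big_ord_recl big_ord0 addr0.
by rewrite (_ : lift ord0 ord0 = 1) //; apply/val_inj.
Qed.

Lemma mx2M a b c d a' b' c' d' :
  mx2 a b c d * mx2 a' b' c' d' =
  mx2 (a * a' + b * c') (a * b' + b * d') (c * a' + d * c') (c * b' + d * d').
Proof. by apply: mx2P; rewrite mulmx2E !mx2E. Qed.

Lemma mx2_scalar a : a%:M = mx2 a 0 0 a.
Proof. by apply: mx2P; rewrite !mxE. Qed.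

Definition mxact M v : D * D :=
  (M 0 0 * v.1 + M 0 1 * v.2, M 1 0 * v.1 + M 1 1 * v.2).

Lemma mxactM M N v : mxact (M * N) v = mxact M (mxact N v).
Proof. by rewrite /mxact !mulmx2E /=; congr (_, _); ring. Qed.

Lemma mxact1 v : mxact 1 v = v.
Proof. by rewrite /mxact !mxE /= !mul0r !mul1r addr0 add0r; case: v. Qed.

Context (x y : D).

(** The letters (false, true) and (true, true) are a and b. The matrix of an
    inverse letter is the adjugate, so that everything stays in [D] and words
    are represented up to a scalar. The matrices form one member of the family
    of all pairs whose commutator is diagonal: after scaling, such a pair is
      a = (m, r; k r - m + 1, 1) and b = (1, 1; m k, m),
    with commutator diag(m, 1/m). The choice m = x^3 and r = k = x separates
    the degrees of the fixed points of the conjugates of the commutator, which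
    makes the four sets [region] below disjoint. *)
Definition letter_mx (l : bool * bool) : 'M[D]_2 :=
  match l with
  | (false, true) => mx2 (x ^+ 3) x (1 + x ^+ 2 - x ^+ 3) 1
  | (false, false) => mx2 1 (- x) (x ^+ 3 - x ^+ 2 - 1) (x ^+ 3)
  | (true, true) => mx2 1 1 (x ^+ 4) (x ^+ 3)
  | (true, false) => mx2 (x ^+ 3) (- 1) (- x ^+ 4) 1
  end.

Definition letter_det (b : bool) : D := if b then x ^+ 3 - x ^+ 4 else x ^+ 4 - x.

Lemma letter_mxV b s :
  letter_mx (b, s) * letter_mx (b, ~~ s) = (letter_det b)%:M.
Proof.
rewrite mx2_scalar; case: b s => -[] /=; rewrite mx2M /letter_det;
  by apply: mx2P; rewrite !mx2E; ring.
Qed.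

Definition free_mx (u : word bool) : 'M[D]_2 := \prod_(l <- u) letter_mx l.

Lemma free_mx_nil : free_mx [::] = 1.
Proof. exact: big_nil. Qed.

Lemma free_mx_cons l u : free_mx (l :: u) = letter_mx l * free_mx u.
Proof. exact: big_cons. Qed.

Lemma free_mx_cat u w : free_mx (u ++ w) = free_mx u * free_mx w.
Proof. exact: big_cat. Qed.

Definition comm_word : word bool :=
  [:: (false, true); (true, true); (false, false); (true, false)].

(** The product of the determinants of a and b is comm_det x * x ^+ 3; the
    word a b a^-1 b^-1 goes to this scalar times diag(x^3, x^-3). *)
Definition comm_det : D := (x ^+ 4 - x) * (1 - x).

Lemma free_mx_comm :
  free_mx comm_word = mx2 (comm_det * x ^+ 6) 0 0 comm_det.
Proof.
rewrite /comm_word !free_mx_cons free_mx_nil mulr1 /= !mx2M /comm_det.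
by apply: mx2P; rewrite !mx2E; ring.
Qed.

Lemma free_mx_commV :
  free_mx (word_inv comm_word) = mx2 comm_det 0 0 (comm_det * x ^+ 6).
Proof.
rewrite /comm_word /word_inv /= !free_mx_cons free_mx_nil mulr1 /= !mx2M.
by rewrite /comm_det; apply: mx2P; rewrite !mx2E; ring.
Qed.

(** An involution of the projective line exchanging the fixed points 0 and
    infinity of the diagonal matrices, hence inverting the commutator. *)
Definition swap_mx : 'M[D]_2 := mx2 0 y 1 0.

Definition orb_letter_mx (l : option bool * bool) : 'M[D]_2 :=
  if l.1 is Some b then letter_mx (b, l.2) else swap_mx.

Definition orb_mx (w : word (option bool)) : 'M[D]_2 :=
  \prod_(l <- w) orb_letter_mx l.

Definition incl (u : word bool) : word (option bool) :=
  [seq (Some l.1, l.2) | l <- u].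

Lemma orb_mx_cat u w : orb_mx (u ++ w) = orb_mx u * orb_mx w.
Proof. exact: big_cat. Qed.

Lemma orb_mx_incl u : orb_mx (incl u) = free_mx u.
Proof. by rewrite /orb_mx big_map; apply: eq_bigr => -[]. Qed.

End Matrices.

Lemma orb_mx_cons (D : comNzRingType) (x y : D) l (u : word (option bool)) :
  orb_mx x y (l :: u) = orb_letter_mx x y l * orb_mx x y u.
Proof. exact: big_cons. Qed.

Lemma swap_mull (D : comNzRingType) (y : D) (N : 'M[D]_2) :
  swap_mx y * N = mx2 (y * N 1 0) (y * N 1 1) (N 0 0) (N 0 1).
Proof. by apply: mx2P; rewrite mulmx2E !mx2E; ring. Qed.

Lemma swap_mulr (D : comNzRingType) (y : D) (N : 'M[D]_2) :
  N * swap_mx y = mx2 (N 0 1) (y * N 0 0) (N 1 1) (y * N 1 0).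
Proof. by apply: mx2P; rewrite mulmx2E !mx2E; ring. Qed.

Lemma map_mx2 (D E : comNzRingType) (f : {rmorphism D -> E}) a b c d :
  map_mx f (mx2 a b c d) = mx2 (f a) (f b) (f c) (f d).
Proof. by apply: mx2P; rewrite !mxE. Qed.

Lemma map_letter_mx (D E : comNzRingType) (f : {rmorphism D -> E}) x l :
  map_mx f (letter_mx x l) = letter_mx (f x) l.
Proof.
by case: l => -[] [] /=; rewrite map_mx2 !rmorphE.
Qed.

Lemma map_free_mx (D E : comNzRingType) (f : {rmorphism D -> E}) x u :
  map_mx f (free_mx x u) = free_mx (f x) u.
Proof.
by rewrite /free_mx rmorph_prod; apply: eq_bigr => l _; apply: map_letter_mx.
Qed.

Lemma map_orb_mx (D E : comNzRingType) (f : {rmorphism D -> E}) x y w :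
  map_mx f (orb_mx x y w) = orb_mx (f x) (f y) w.
Proof.
rewrite /orb_mx rmorph_prod; apply: eq_bigr => -[[b|] s] _ /=.
  exact: map_letter_mx.
by rewrite map_mx2 rmorph0 rmorph1.
Qed.

(** Stated on entries, to be transported along ring morphisms without
    exhibiting the scalar. *)
Definition is_scalar (D : nzRingType) (M : 'M[D]_2) : Prop :=
  [/\ M 0 1 = 0, M 1 0 = 0 & M 0 0 = M 1 1].

Lemma is_scalar_map (D1 D2 : nzRingType) (m : {rmorphism D1 -> D2}) (M : 'M_2) :
  is_scalar M -> is_scalar (map_mx m M).
Proof. by case=> e01 e10 e; split; rewrite !mxE ?e01 ?e10 ?e ?rmorph0. Qed.

(** * Ping-pong for the degree in x *)

Section Collinear.
Context (D : idomainType).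
Implicit Types (M : 'M[D]_2) (v w : D * D).

(** Equality of points of the projective line over the fraction field, without
    denominators. *)
Definition collinear v w := exists k l,
  [/\ k != 0, l != 0, k * v.1 = l * w.1 & k * v.2 = l * w.2].

Lemma collinear_sym v w : collinear v w -> collinear w v.
Proof. by case=> k [l [k0 l0 e1 e2]]; exists l, k. Qed.

Lemma collinear_trans v w z : collinear v w -> collinear w z -> collinear v z.
Proof.
case=> k [l [k0 l0 e1 e2]] [k' [l' [k0' l0' e1' e2']]].
exists (k * k'), (l * l'); split; rewrite ?mulf_neq0 //.
  by rewrite mulrAC e1 mulrAC -!mulrA e1'.
by rewrite mulrAC e2 mulrAC -!mulrA e2'.
Qed.

Lemma collinear_act M v w : collinear v w -> collinear (mxact M v) (mxact M w).
Proof.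
case=> k [l [k0 l0 e1 e2]]; exists k, l; split=> //=;
  by rewrite !mulrDr !(mulrCA k) !(mulrCA l) e1 e2.
Qed.

Lemma collinear_scalar d v : d != 0 -> collinear (mxact d%:M v) v.
Proof.
move=> d0; exists 1, d; split; rewrite ?oner_eq0 // mx2_scalar /mxact !mx2E /=; ring.
Qed.

End Collinear.

Section PingPong.
Context (F : fieldType).
Local Notation P := {poly F}.
Implicit Types (v w : P * P) (l s t : bool * bool) (u : word bool).

Local Notation X := ('X : P).
Local Notation L := (letter_mx X).

Definition letter_inv l : bool * bool := (l.1, ~~ l.2).

Lemma letter_invK : involutive letter_inv.
Proof. by case=> b s; rewrite /letter_inv /= negbK. Qed.

(** The ping-pong set of a letter: a disc of the projective line for the degree
    valuation. In the coordinate z = v.1 / v.2 they are |z| >= 1 for a,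
    |z| <= |x^-3| for b, and the open discs around -1/x and -1/x^2 of radius
    |1/x| and |1/x^2| for b^-1 and a^-1. *)
Definition region l v : bool :=
  match l with
  | (false, true) => (v.1 != 0) && (size v.2 <= size v.1)%N
  | (true, true) => (v.2 != 0) && (size (X ^+ 3 * v.1)%R <= size v.2)%N
  | (true, false) => (size (X * v.1 + v.2)%R < size v.2)%N
  | (false, false) => (size (X ^+ 2 * v.1 + v.2)%R < size v.2)%N
  end.

Lemma size_Xnmul n (p : P) :
  size (X ^+ n * p) = if p == 0 then 0%N else (n + size p)%N.
Proof.
have [->|p0] := eqVneq; first by rewrite mulr0 size_poly0.
by rewrite size_monicM ?monicXn // size_polyXn.
Qed.

(** The ultrametric inequality, in a form where the decomposition of [r] is left
    to [ring]. *)
Lemma size_le_add n (p q r : P) : r = p + q ->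
  (size p <= n)%N -> (size q <= n)%N -> (size r <= n)%N.
Proof.
by move=> -> pn qn; apply: leq_trans (size_polyD _ _) _; rewrite geq_max pn.
Qed.

Lemma size_le_sub n (p q r : P) : r = p - q ->
  (size p <= n)%N -> (size q <= n)%N -> (size r <= n)%N.
Proof. by move=> e; rewrite -(size_polyN q); apply: size_le_add. Qed.

Lemma size_Xmul (p : P) : size (X * p) = if p == 0 then 0%N else (size p).+1.
Proof. exact: (size_Xnmul 1). Qed.

Lemma size_Xnmul_le n (p : P) : (size (X ^+ n * p)%R <= n + size p)%N.
Proof. by rewrite size_Xnmul; case: ifP. Qed.

Lemma size_le_Xnmul n (p : P) : (size p <= size (X ^+ n * p)%R)%N.
Proof.
by rewrite size_Xnmul; case: eqP => [->|_]; rewrite ?size_poly0 ?leq_addl.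
Qed.

Lemma size_mul_mono (k p q : P) : k != 0 ->
  (size (k * p)%R <= size (k * q)%R)%N = (size p <= size q)%N.
Proof.
move=> k0; have [->|p0] := eqVneq p 0; first by rewrite mulr0 size_poly0.
have [->|q0] := eqVneq q 0.
  by rewrite mulr0 size_poly0 !leqn0 !size_poly_eq0 mulf_eq0 (negPf k0).
rewrite !size_mul //; have k1 : size k != 0%N by rewrite size_poly_eq0.
have p1 : size p != 0%N by rewrite size_poly_eq0.
by move: (size k) (size p) (size q) k1 p1 => [|a] [|b] c //= _ _; rewrite leq_add2l.
Qed.

Lemma region_scale l (k : P) v :
  k != 0 -> region l (k * v.1, k * v.2) = region l v.
Proof.
move=> k0; case: l => -[] [] /=; rewrite ?mulf_eq0 ?(negPf k0) /=;
  rewrite ?(mulrCA _ k) -?mulrDr ?ltnNge ?size_mul_mono //.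
Qed.

Lemma region_collinear l v w : collinear v w -> region l v -> region l w.
Proof.
by case=> k [m [k0 m0 e1 e2]]; rewrite -(region_scale l v k0) e1 e2 region_scale.
Qed.

(** If adding [q] to [X ^+ n * p] produces a cancellation, both terms have the
    same degree. *)
Lemma size_dom n (p q : P) : (size (X ^+ n * p + q)%R < size q)%N ->
  p != 0 /\ size q = (n + size p)%N.
Proof.
move=> h; have e : size (X ^+ n * p) = size q.
  have -> : X ^+ n * p = (X ^+ n * p + q) - q by ring.
  by rewrite addrC size_polyDl ?size_polyN.
have := e; rewrite size_Xnmul; case: eqP => // _ e0.
by move: h; rewrite -e0.
Qed.

(** The degrees alone already tell the four discs apart. *)
Lemma region_size l v : region l v ->
  let m := size v.1 in let n := size v.2 in
  match l with
  | (false, true) => (0 < m) && (n <= m)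
  | (true, true) => (0 < n) && ((m == 0) || (3 + m <= n))
  | (true, false) => (0 < m) && (n == 1 + m)
  | (false, false) => (0 < m) && (n == 2 + m)
  end%N.
Proof.
case: l => -[] [] /=; rewrite ?size_poly_gt0.
- by rewrite size_Xnmul size_poly_eq0; case: ifP.
- by rewrite -{1}(expr1 X) => /size_dom[-> ->]; rewrite eqxx.
- by [].
- by move=> /size_dom[-> ->]; rewrite eqxx.
Qed.

Lemma region_disjoint s t v : region s v -> region t v -> s = t.
Proof.
move=> /region_size + /region_size; move: (size v.1) (size v.2) => m n.
by case: s t => -[] [] [] [] [] //=; lia.
Qed.

Lemma region_neq0 s v : region s v -> v != (0, 0).
Proof.
move/region_size; apply: contraTneq => -> /=; rewrite size_poly0.
by case: s => -[] [].
Qed.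

(** Each letter sends the complement of the disc of its inverse into its own
    disc. All four cases are the ultrametric inequality, applied to a
    combination of the coordinates of the image that cancels: for b the image
    is (p + q, x^3 (x p + q)); for b^-1, x w.1 + w.2 = (1 - x) q; for a,
    w.1 = x (x^2 p + q); for a^-1, x^2 w.1 + w.2 = (x^3 - 1) p. *)
Lemma pingpong s v : v != (0, 0) -> ~~ region (letter_inv s) v ->
  region s (mxact (L s) v).
Proof.
case: v => p q; rewrite xpair_eqE /= => v0.
have X0 n : X ^+ n != 0 by rewrite monic_neq0 ?monicXn.
case: s => -[] [] /=; rewrite /mxact !mx2E /= -?leqNgt.
- move=> h.
  have hp : (size (X * p)%R <= size (X * p + q)%R)%N.
    by apply: (@size_le_sub _ (X * p + q) q); rewrite ?addrK.
  have hp' : (size p <= size (X * p + q)%R)%N.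
    by apply: leq_trans hp; apply: (size_le_Xnmul 1).
  have -> : X ^+ 4 * p + X ^+ 3 * q = X ^+ 3 * (X * p + q) by ring.
  rewrite size_mul_mono // !mul1r mulf_neq0 //=; first exact: size_le_add hp' h.
  apply: contraNneq v0 => e; move: h hp'; rewrite e size_poly0 !leqn0.
  by rewrite !size_poly_eq0 => -> ->.
- move=> h.
  have {h} [p0 h] : p != 0 /\ (size q < 3 + size p)%N.
    move: h v0; rewrite size_Xnmul; have [-> /=|p0] := eqVneq p 0.
      by rewrite size_poly0 leq0n andbT negbK => ->.
    by rewrite negb_and negbK -ltnNge => /orP[/eqP->|//]; rewrite size_poly0.
  have e4 : size (- X ^+ 4 * p + 1 * q) = (4 + size p)%N.
    rewrite mul1r size_polyDl mulNr size_polyN size_Xnmul (negPf p0) //.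
    by apply: ltn_trans h _; rewrite ltn_add2r.
  rewrite e4 ltnS; apply: (@size_le_sub _ q (X * q)); first by ring.
    exact: ltnW.
  by rewrite size_Xmul; case: eqP.
- move=> h.
  have -> : X ^+ 3 * p + X * q = X * (X ^+ 2 * p + q) by ring.
  have hp : (size (X ^+ 2 * p)%R <= size (X ^+ 2 * p + q)%R)%N.
    by apply: (@size_le_sub _ (X ^+ 2 * p + q) q); rewrite ?addrK.
  have r0 : X ^+ 2 * p + q != 0.
    apply: contraNneq v0 => e; move: h hp; rewrite e size_poly0 !leqn0.
    by rewrite !size_poly_eq0 mulf_eq0 (negPf (X0 2)) /= => -> ->.
  rewrite mulf_neq0 ?(X0 1%N) //= size_Xmul (negPf r0).
  have h3 : (size (X ^+ 3 * p)%R <= (size (X ^+ 2 * p + q)%R).+1)%N.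
    by rewrite (_ : X ^+ 3 * p = X * (X ^+ 2 * p)) ?size_Xmul; [case: ifP|ring].
  have h2 : (size (X ^+ 2 * p)%R <= (size (X ^+ 2 * p + q)%R).+1)%N by apply: leqW.
  have h0 : (size p <= (size (X ^+ 2 * p + q)%R).+1)%N.
    exact: leq_trans (size_le_Xnmul 2 p) h2.
  apply: (@size_le_add _ ((1 + X ^+ 2 - X ^+ 3) * p) q); first by rewrite mul1r.
    apply: (@size_le_sub _ (p + X ^+ 2 * p) (X ^+ 3 * p)) => //; first by ring.
    exact: size_le_add h0 h2.
  exact: leqW.
- move=> h.
  have {h} [q0 h] : q != 0 /\ (size p < size q)%N.
    move: h v0; have [-> /=|p0] := eqVneq p 0.
      by move=> _ q0; rewrite size_poly0 size_poly_gt0.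
    rewrite /= -ltnNge => h _; split=> //.
    by apply: contraTneq h => ->; rewrite size_poly0.
  have h3 : (size (X ^+ 3 * p)%R < 3 + size q)%N.
    by apply: leq_ltn_trans (size_Xnmul_le _ _) _; rewrite ltn_add2l.
  have h2 : (size (X ^+ 2 * p)%R < 3 + size q)%N.
    by apply: leq_ltn_trans (size_Xnmul_le _ _) _; lia.
  have h0 : (size p < 3 + size q)%N by lia.
  have e3 : size ((X ^+ 3 - X ^+ 2 - 1) * p + X ^+ 3 * q) = (3 + size q)%N.
    rewrite addrC size_polyDl size_Xnmul (negPf q0) // ltnS.
    apply: (@size_le_sub _ (X ^+ 3 * p - X ^+ 2 * p) p) => //; first by ring.
    exact: size_le_sub h3 h2.
  by rewrite e3 ltnS; apply: (size_le_sub _ h3 h0); ring.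
Qed.
End PingPong.

(** * The stabilizer of (1 : 0) in the free group *)

Section Cyclic.
Local Open Scope group_scope.
Context (G : groupType) (c : G).

(** The cyclic subgroup generated by [c]; the two natural exponents avoid
    integer powers. *)
Definition in_cycle (h : G) : Prop := exists i j, h = c ^+ i * c ^- j.

Lemma cycle_commute i j : commute (c ^+ i) (c ^- j).
Proof. exact/commuteV/commuteX2/commute_refl. Qed.

Lemma in_cycle1 : in_cycle 1.
Proof. by exists 0%N, 0%N; rewrite mulgV. Qed.

Lemma in_cycle_id : in_cycle c.
Proof. by exists 1%N, 0%N; rewrite invg1 mulg1. Qed.

Lemma in_cycleM g h : in_cycle g -> in_cycle h -> in_cycle (g * h).
Proof.
move=> [i [j ->]] [k [l ->]]; exists (i + k)%N, (l + j)%N.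
rewrite !expgnDr invgM -!mulgA; congr (_ * _).
by rewrite !mulgA; congr (_ * _); exact/esym/cycle_commute.
Qed.

Lemma in_cycleV g : in_cycle g -> in_cycle g^-1.
Proof. by move=> [i [j ->]]; exists j, i; rewrite invgM invgK. Qed.

End Cyclic.

Section Stabilizer.
Context (F : fieldType).
Local Notation P := {poly F}.
Implicit Types (v w : P * P) (l s t : bool * bool) (u : word bool).

Local Notation X := ('X : P).
Local Notation L := (letter_mx X).
Local Notation M := (free_mx X).

Lemma polyXn_sub1_neq0 n : (0 < n)%N -> X ^+ n - 1 != 0.
Proof.
move=> n0; rewrite subr_eq0; apply/eqP=> e; have := size_polyXn F n.
by rewrite e size_poly1; case: n n0 {e}.
Qed.

Lemma size_cubic : size (X ^+ 3 - X ^+ 2 - 1) = 4%N.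
Proof.
rewrite -addrA size_polyDl size_polyXn // -opprD size_polyN.
by rewrite size_polyDl ?size_polyXn ?size_poly1.
Qed.

Lemma letter_det_neq0 b : letter_det X b != 0.
Proof.
have X0 n : X ^+ n != 0 by rewrite monic_neq0 ?monicXn.
have -> : letter_det X b =
    if b then X ^+ 3 * - (X ^+ 1 - 1) else X ^+ 1 * (X ^+ 3 - 1).
  by case: b; rewrite /letter_det; ring.
by case: b; rewrite mulf_neq0 // ?oppr_eq0 polyXn_sub1_neq0.
Qed.

Lemma one_subX_neq0 : 1 - X != 0.
Proof. by rewrite -opprB oppr_eq0 (polyXn_sub1_neq0 (n := 1)). Qed.

Lemma mxact_letterK s v : collinear (mxact (L (letter_inv s)) (mxact (L s) v)) v.
Proof.
case: s => b s; rewrite -mxactM.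
have := letter_mxV X b (~~ s); rewrite /letter_inv negbK => ->.
exact/collinear_scalar/letter_det_neq0.
Qed.

Lemma mxact_letterVK s v : collinear (mxact (L s) (mxact (L (letter_inv s)) v)) v.
Proof. by have := mxact_letterK (letter_inv s) v; rewrite letter_invK. Qed.

Lemma mxact_free_neq0 u v : v != (0, 0) -> mxact (M u) v != (0, 0).
Proof.
move=> v0; elim: u => [|l u IH]; first by rewrite free_mx_nil mxact1.
rewrite free_mx_cons mxactM; apply: contraNneq IH => e.
have [k [m [_ m0]]] := mxact_letterK l (mxact (M u) v).
rewrite e /mxact /= !mulr0 addr0 !mulr0 => /esym/eqP + /esym/eqP.
by rewrite !mulf_eq0 (negPf m0) xpair_eqE /= => -> ->.
Qed.

(** Reading the periodic word c c c ... from its first, second, third and fourth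
    letter gives four ends of the free group. Each of the four letters starts
    exactly one of them, and [axis_pt] is the corresponding point of the
    projective line: the images of (1 : 0) under 1, a^-1, b^-1 a^-1 and
    a b^-1 a^-1, cleared of common factors. *)
Definition axis_pt l : P * P :=
  match l with
  | (false, true) => (1, 0)
  | (true, true) => (1, X ^+ 3 - X ^+ 2 - 1)
  | (false, false) => (X ^+ 2 + 1, - X ^+ 4 + X ^+ 3 - X ^+ 2 - 1)
  | (true, false) => (1, - X)
  end.

(** The letter following [l] in the periodic word c c c ... *)
Definition axis_next l : bool * bool := (~~ l.1, l.1 (+) l.2).

Lemma axis_pt_region s : region s (axis_pt s).
Proof.
case: s => -[] [] /=.
- by rewrite mulr1 size_cubic size_polyXn -size_poly_eq0 size_cubic.
- by rewrite mulr1 subrr size_poly0 size_polyN size_polyX.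
- by rewrite size_poly0 oner_eq0.
- have -> : X ^+ 2 * (X ^+ 2 + 1) + (- X ^+ 4 + X ^+ 3 - X ^+ 2 - 1) = X ^+ 3 - 1.
    by ring.
  rewrite size_polyDl ?size_polyN ?size_polyXn ?size_poly1 //.
  by rewrite -!addrA size_polyDl size_polyN size_polyXn // addrA size_cubic.
Qed.

Lemma axis_pt_next s :
  collinear (mxact (L (letter_inv s)) (axis_pt s)) (axis_pt (axis_next s)).
Proof.
case: s => -[] []; rewrite /mxact /= !mx2E /=.
- by exists 1, 1; rewrite !oner_eq0; split=> //=; ring.
- exists 1, (1 - X); split; rewrite ?oner_eq0 //=; try ring.
  exact: one_subX_neq0.
- by exists 1, 1; rewrite !oner_eq0; split=> //=; ring.
- exists 1, (X ^+ 4 - X); split; rewrite ?oner_eq0 //=; try ring.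
  exact: (letter_det_neq0 false).
Qed.

(** A word acting on a point of the disc of [s] either can be shortened, by an
    inner cancellation or a cancellation with [s], or moves the point to the
    disc of its first letter, as reduced words do in ping-pong. *)
Lemma free_word_cases u s v : region s v ->
  [\/ exists p l q, u = p ++ [:: l, letter_inv l & q],
      exists p, u = rcons p (letter_inv s)
    | region (head s u) (mxact (M u) v)].
Proof.
move=> sv; elim: u => [|l u [[p [k [q ->]]]|[p ->]|]].
- by apply: Or33; rewrite free_mx_nil mxact1.
- by apply: Or31; exists (l :: p), k, q.
- by apply: Or32; exists (l :: p).
have [|ul] := boolP (region (letter_inv l) (mxact (M u) v)).
  move=> r1 /(region_disjoint r1); case: u {r1} => /= [<-|k u <-].
    by apply: Or32; exists [::]; rewrite letter_invK.
  by apply: Or31; exists [::], l, u.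
move=> uv; apply: Or33 => /=; rewrite free_mx_cons mxactM.
exact: pingpong (region_neq0 uv) ul.
Qed.

Section Group.
Local Open Scope group_scope.
Context (G : groupType) (h : bool -> G).
Local Notation E := (word_eval h).
Local Notation cycle := (in_cycle (E comm_word)).

(** The element carrying [axis_pt l] back to (1 : 0): the prefix of c that ends
    just before [l]. *)
Definition axis_path l : word bool :=
  match l with
  | (false, true) => [::]
  | (true, true) => [:: (false, true)]
  | (false, false) => [:: (false, true); (true, true)]
  | (true, false) => [:: (false, true); (true, true); (false, false)]
  end.

Lemma axis_path_next s :
  cycle (E (axis_path s) * letter_eval h s * (E (axis_path (axis_next s)))^-1).
Proof.
rewrite -(mulg1 (letter_eval h s)) -(word_eval_nil h) -word_eval_cons -word_eval_cat.
case: s => -[] []; rewrite /= ?mulgV; try exact: in_cycle1.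
by rewrite (word_eval_nil h) invg1 mulg1; exact: in_cycle_id.
Qed.

Lemma letter_eval_invE l : letter_eval h (letter_inv l) = (letter_eval h l)^-1.
Proof. by case: l => b []; rewrite /letter_eval /= ?invgK. Qed.

(** Induction on the length of [u]. If [u] is reduced and does not cancel with
    the letter [s] starting the itinerary of its argument, then its first letter
    has to start the itinerary of the value, so it is [t] and can be stripped;
    if it ends with the inverse of [s], that letter just advances the argument
    along the axis. *)
Lemma axis_translation u s t :
  collinear (mxact (M u) (axis_pt s)) (axis_pt t) ->
  cycle (E (axis_path t) * E u * (E (axis_path s))^-1).
Proof.
have [n] := ubnP (size u); elim: n u s t => // n IH u s t.
rewrite ltnS => un ut.
have [[p [l [q uE]]]|[p uE]|r] := free_word_cases u (axis_pt_region s).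
- have -> : E u = E (p ++ q).
    by rewrite uE !word_eval_cat !word_eval_cons letter_eval_invE mulVKg.
  apply: IH; first by move: un; rewrite uE !size_cat /=; lia.
  apply: collinear_trans ut; rewrite uE !free_mx_cat !free_mx_cons !mxactM.
  exact/collinear_act/collinear_sym/mxact_letterVK.
- have pt : collinear (mxact (M p) (axis_pt (axis_next s))) (axis_pt t).
    apply: collinear_trans ut; rewrite uE -cats1 free_mx_cat mxactM.
    rewrite free_mx_cons free_mx_nil mulr1.
    exact/collinear_act/collinear_sym/axis_pt_next.
  have pn : (size p < n)%N by move: un; rewrite uE size_rcons.
  have := in_cycleM (IH _ _ _ pn pt) (in_cycleV (axis_path_next s)).
  have -> : E u = E p * (letter_eval h s)^-1.
    by rewrite uE -cats1 word_eval_cat word_eval_cons word_eval_nil mulg1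
      letter_eval_invE.
  by rewrite !invgM invgK !mulgA mulgVK.
- have {r} := region_disjoint (region_collinear ut r) (axis_pt_region t).
  case: u un ut => [_ _ /= ->|l u un ut /= lt].
    by rewrite word_eval_nil mulg1 mulgV; exact: in_cycle1.
  rewrite {l}lt in un ut *.
  have ut' : collinear (mxact (M u) (axis_pt s)) (axis_pt (axis_next t)).
    apply: collinear_trans (axis_pt_next t).
    apply: collinear_trans (collinear_act _ ut).
    by rewrite free_mx_cons mxactM; apply/collinear_sym/mxact_letterK.
  have := in_cycleM (axis_path_next t) (IH _ _ _ un ut').
  by rewrite (word_eval_cons h t u) !mulgA mulgVK.
Qed.

(** The case of [axis_translation] where both points are (1 : 0): a zero lower
    left entry means that (1 : 0) is fixed. The group is arbitrary because only
    free reductions are used. *)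
Lemma stabilizer_cycle u : M u 1%R 0%R = 0%R -> cycle (E u).
Proof.
move=> u10; have := @axis_translation u (false, true) (false, true).
rewrite word_eval_nil invg1 mulg1 mul1g; apply.
have e : mxact (M u) (axis_pt (false, true)) = (M u 0%R 0%R, 0%R).
  by rewrite /mxact /= u10 !mulr1 !mulr0 !addr0.
exists 1%R, (M u 0%R 0%R); rewrite e /= !mulr1 !mulr0 mul1r oner_eq0; split=> //.
have := @mxact_free_neq0 u (1, 0)%R; rewrite [mxact _ _]e !xpair_eqE !eqxx !andbT.
by apply; rewrite oner_eq0.
Qed.

End Group.
End Stabilizer.

(** * Normal forms in Gamma *)

Definition cycle_word i j : word bool :=
  flatten (nseq i comm_word) ++ flatten (nseq j (word_inv comm_word)).

Lemma free_mx_cycle (D : comNzRingType) (x : D) i j :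
  let d := comm_det x ^+ (i + j) in
  free_mx x (cycle_word i j) = mx2 (d * x ^+ (6 * i)) 0 0 (d * x ^+ (6 * j)).
Proof.
have e1 : free_mx x (flatten (nseq i comm_word)) =
    mx2 (comm_det x ^+ i * x ^+ (6 * i)) 0 0 (comm_det x ^+ i).
  elim: i => [|i IH]; first by rewrite free_mx_nil muln0 mulr1 expr0 -mx2_scalar.
  have -> : flatten (nseq i.+1 comm_word) =
    comm_word ++ flatten (nseq i comm_word) by [].
  rewrite free_mx_cat IH free_mx_comm mx2M.
  rewrite !(exprS _ i) mulnS exprD; move: (x ^+ (6 * i)) (_ ^+ i) => z z'.
  by apply: mx2P; rewrite !mx2E; ring.
have e2 : free_mx x (flatten (nseq j (word_inv comm_word))) =
    mx2 (comm_det x ^+ j) 0 0 (comm_det x ^+ j * x ^+ (6 * j)).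
  elim: j => [|j IH]; first by rewrite free_mx_nil muln0 mulr1 expr0 -mx2_scalar.
  have -> : flatten (nseq j.+1 (word_inv comm_word)) =
     word_inv comm_word ++ flatten (nseq j (word_inv comm_word)) by [].
  rewrite free_mx_cat IH free_mx_commV mx2M.
  rewrite !(exprS _ j) mulnS exprD; move: (x ^+ (6 * j)) (_ ^+ j) => z z'.
  by apply: mx2P; rewrite !mx2E; ring.
rewrite /= free_mx_cat e1 e2 mx2M.
rewrite exprD; move: (x ^+ _) (x ^+ _) (_ ^+ i) (_ ^+ j) => z1 z2 z3 z4.
by apply: mx2P; rewrite !mx2E; ring.
Qed.

Section NormalForm.
Context (F : fieldType).
Implicit Types (u v : word bool) (us : seq (word bool)).

(** In view of [stabilizer_cycle], the moving words are those that do not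
    represent a power of c. *)
Definition moving u : bool := free_mx ('X : {poly F}) u 1 0 != 0.

Definition twist (e : bool) : word (option bool) := nseq e (None, true).

Definition alternate u us : word (option bool) :=
  incl u ++ flatten [seq (None, true) :: incl v | v <- us].

(** The normal forms of the amalgamated product: elements of the dihedral factor
    that have the form c^k or c^k t, and alternating products. *)
Inductive normal : word (option bool) -> Prop :=
| normal_cycle i j e : normal (incl (cycle_word i j) ++ twist e)
| normal_alternate e u us e' : moving u -> all moving us ->
    normal (twist e ++ alternate u us ++ twist e').

Lemma comm_det_neq0 : comm_det ('X : {poly F}) != 0.
Proof.
rewrite mulf_neq0 //; first exact: (letter_det_neq0 F false).
exact: one_subX_neq0.
Qed.

Lemma moving_cycle i j u : moving u -> moving (cycle_word i j ++ u).
Proof.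
rewrite /moving free_mx_cat free_mx_cycle mulmx2E !mx2E mul0r add0r.
by move=> u0; rewrite !mulf_neq0 ?expf_neq0 ?comm_det_neq0 ?polyX_eq0.
Qed.

Lemma moving_letter l : moving [:: l].
Proof.
rewrite /moving free_mx_cons free_mx_nil mulr1.
have X0 n : ('X : {poly F}) ^+ n != 0 by rewrite monic_neq0 ?monicXn.
case: l => -[] [] /=; rewrite mx2E ?oppr_eq0 //.
  rewrite (_ : 1 + _ - _ = - ('X ^+ 3 - 'X ^+ 2 - 1)); last by ring.
  by rewrite oppr_eq0 -size_poly_eq0 size_cubic.
by rewrite -size_poly_eq0 size_cubic.
Qed.

Section Group.
Local Open Scope group_scope.
Context (G : groupType) (f : option bool -> G).
Local Notation t := (f None).
Local Notation h := (fun b => f (Some b)).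
Local Notation c := (word_eval h comm_word).
Context (tt1 : t * t = 1) (tct : t * c * t = c^-1).

Lemma word_eval_incl u : word_eval f (incl u) = word_eval h u.
Proof. by rewrite /word_eval big_map; apply: eq_bigr. Qed.

Lemma twist_eval0 : word_eval f (twist false) = 1.
Proof. exact: word_eval_nil. Qed.

Lemma twist_eval1 : word_eval f (twist true) = t.
Proof. by rewrite word_eval_cons word_eval_nil mulg1. Qed.

Lemma word_eval_cycle i j : word_eval h (cycle_word i j) = c ^+ i * c ^- j.
Proof.
have e w n : word_eval h (flatten (nseq n w)) = word_eval h w ^+ n.
  elim: n => [|n IH]; first exact: word_eval_nil.
  by rewrite expgS -IH -word_eval_cat.
by rewrite word_eval_cat !e word_eval_inv expVgn.
Qed.

(** Powers of c move across t, which is what lets them be absorbed in the next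
    syllable. *)
Lemma twist_cycle g : in_cycle c g -> exists2 g', in_cycle c g' & t * g = g' * t.
Proof.
have tc : c ^ t = c^-1.
  by rewrite conjgE (mulg1_eq tt1) mulgA.
case=> i [j ->]; exists ((c ^+ i * c ^- j) ^ t).
  rewrite conjMg conjVg !conjXg tc; exists j, i.
  by rewrite !expVgn invgK cycle_commute.
by rewrite conjgE (mulg1_eq tt1) -!mulgA tt1 mulg1.
Qed.

Definition reachable (g : G) := exists2 w, normal w & word_eval f w = g.

Lemma reachable_cycle g e : in_cycle c g -> reachable (g * word_eval f (twist e)).
Proof.
case=> i [j ->]; exists (incl (cycle_word i j) ++ twist e).
  exact: normal_cycle.
by rewrite word_eval_cat word_eval_incl word_eval_cycle.
Qed.

Lemma reachable_twist g : reachable g -> reachable (t * g).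
Proof.
case=> w + <- {g}; case=> [i j e|[] u us e' mu mus].
- rewrite word_eval_cat word_eval_incl word_eval_cycle mulgA.
  have [|g' cg' ->] := @twist_cycle (c ^+ i * c ^- j); first by exists i, j.
  rewrite -mulgA (_ : t * _ = word_eval f (twist (~~ e))); first exact: reachable_cycle.
  by case: e; rewrite /= word_eval_cons ?word_eval_nil mulg1.
- exists (twist false ++ alternate u us ++ twist e'); first exact: normal_alternate.
  rewrite !(word_eval_cat _ (twist _)) /= word_eval_cons word_eval_nil mulg1.
  by rewrite mulgA tt1.
- exists (twist true ++ alternate u us ++ twist e'); first exact: normal_alternate.
  by rewrite word_eval_cons.
Qed.

Lemma word_eval_alternate u v us : word_eval f (alternate u (v :: us)) =
  word_eval h u * (t * word_eval f (alternate v us)).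
Proof.
by rewrite /alternate /= !word_eval_cat word_eval_cons word_eval_cat !word_eval_incl.
Qed.

(** The only place where a syllable may degenerate: when the first syllable [u]
    turns out to be a power of c, it is moved across the t that follows and
    absorbed in the next syllable, which stays moving. *)
Lemma reachable_free u us e : all moving us ->
  reachable (word_eval f (alternate u us ++ twist e)).
Proof.
move=> mus; have [u0|mu] := eqVneq (free_mx ('X : {poly F}) u 1%R 0%R) 0%R; last first.
  by exists (twist false ++ alternate u us ++ twist e); first exact: normal_alternate.
have cu := stabilizer_cycle h u0.
case: us mus => [_|v us /andP[mv mus]].
  rewrite word_eval_cat /alternate cats0 word_eval_incl.
  exact: reachable_cycle.
rewrite word_eval_cat word_eval_alternate.
have [g' [i [j ->]] gE] : exists2 g', in_cycle c g' & word_eval h u * t = t * g'.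
  have [g' cg' e'] := twist_cycle (in_cycleV cu).
  exists g'^-1; first exact: in_cycleV.
  apply: invg_inj; rewrite !invgM invgK.
  by rewrite -{1}(mulg1_eq tt1) (mulg1_eq tt1) -e' (mulg1_eq tt1).
exists (twist true ++ alternate (cycle_word i j ++ v) us ++ twist e).
  by apply: normal_alternate => //; apply: moving_cycle.
rewrite !word_eval_cat !word_eval_incl word_eval_cat word_eval_cycle.
by rewrite word_eval_cons word_eval_nil mulg1 !mulgA gE !mulgA.
Qed.

Lemma reachable_letter b s g : reachable g -> reachable (letter_eval f (Some b, s) * g).
Proof.
have el : letter_eval f (Some b, s) = word_eval h [:: (b, s)].
  by rewrite word_eval_cons word_eval_nil mulg1.
case=> w + <- {g}; case=> [i j e|[] u us e' mu mus].
- rewrite -word_eval_cons.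
  have := @reachable_free ((b, s) :: cycle_word i j) [::] e isT.
  by rewrite /alternate cats0.
- exists (twist false ++ alternate [:: (b, s)] (u :: us) ++ twist e').
    by apply: normal_alternate; rewrite ?moving_letter //= mu.
  rewrite !(word_eval_cat f (twist _)) !(word_eval_cat f (alternate _ _)).
  by rewrite word_eval_alternate el twist_eval0 twist_eval1 mul1g !mulgA.
- rewrite -word_eval_cons; exact: (@reachable_free ((b, s) :: u) us e' mus).
Qed.

(** The set of elements having a normal form contains 1 and is stable under left
    multiplication by every letter. *)
Lemma normal_form w : reachable (word_eval f w).
Proof.
elim: w => [|[[b|] s] w IH].
- have := reachable_cycle false (in_cycle1 c).
  by rewrite mul1g.
- by rewrite word_eval_cons; apply: reachable_letter.
- rewrite word_eval_cons (_ : letter_eval _ _ = t); first exact: reachable_twist.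
  by case: s => //; apply/mulg1_eq.
Qed.
End Group.
End NormalForm.

(** * Ping-pong for the degree in y *)

Section SecondPingPong.
Context (F : fieldType).
Local Notation P := {poly F}.
Local Notation R := {poly P}.
Implicit Types (v w : R * R) (u : word bool) (us : seq (word bool)).
Local Notation Q := (orb_mx ('X%:P : R) ('X : R)).
Local Notation M := (free_mx ('X : P)).

Lemma size_constM (a : P) (p : R) : (size (a%:P * p)%R <= size p)%N.
Proof. by rewrite mul_polyC size_scale_leq. Qed.

(** The value at infinity (for the degree in y) of the point [w] is the image
    of (1 : 0) under [M u], and this image is not (1 : 0); the third condition
    remembers the first syllable [u]. *)
Definition in_fan u w : Prop :=
  [/\ w.2 != 0, (size w.1 <= size w.2)%N
    & (size ((M u 1 0)%:P * w.1 - (M u 0 0)%:P * w.2)%R < size w.2)%N].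

(** A point with [v.2] of smaller degree in y than [v.1] reduces to (1 : 0), and
    a matrix with constant entries in y acts through the reduction. *)
Lemma moving_act u v : moving F u -> (size v.2 < size v.1)%N ->
  in_fan u (mxact (Q (incl u)) v).
Proof.
case: v => p q /= mu qp; rewrite orb_mx_incl -(map_free_mx (@polyC P)) /mxact !mxE /=.
have e : size ((M u 1 0)%:P * p + (M u 1 1)%:P * q) = size p.
  have e : size ((M u 1 0)%:P * p) = size p by rewrite size_Cmul.
  by rewrite size_polyDl e // (leq_ltn_trans (size_constM _ _) qp).
split; rewrite /= ?e.
- by rewrite -size_poly_eq0 e -lt0n; apply: leq_ltn_trans qp.
- apply: leq_trans (size_polyD _ _) _; rewrite geq_max size_constM.
  exact: leq_trans (size_constM _ _) (ltnW qp).
- have -> : (M u 1 0)%:P * ((M u 0 0)%:P * p + (M u 0 1)%:P * q) -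
      (M u 0 0)%:P * ((M u 1 0)%:P * p + (M u 1 1)%:P * q)
    = (M u 1 0 * M u 0 1 - M u 0 0 * M u 1 1)%:P * q.
    by rewrite polyCB !polyCM; ring.
  exact: leq_ltn_trans (size_constM _ _) qp.
Qed.

Lemma swap_act v : v.2 != 0 -> (size v.1 <= size v.2)%N ->
  let w := mxact (swap_mx ('X : R)) v in (size w.2 < size w.1)%N.
Proof.
move=> v20 v12; rewrite /= /mxact !mx2E /= !mul0r add0r addr0 mul1r.
by rewrite mulrC size_mulX.
Qed.

Lemma orb_mx_alternate (D : comNzRingType) (x y : D) (u u' : word bool) us :
  orb_mx x y (alternate u (u' :: us)) =
  orb_mx x y (incl u) * (swap_mx y * orb_mx x y (alternate u' us)).
Proof. by rewrite orb_mx_cat orb_mx_cons. Qed.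

(** The matrix of t sends every point that does not reduce to (1 : 0) to one that
    does; so the syllables and t play ping-pong. *)
Lemma alternate_act u us v : moving F u -> all (moving F) us ->
  (size v.2 < size v.1)%N -> in_fan u (mxact (Q (alternate u us)) v).
Proof.
move=> + + hv; elim: us u => [|u' us IH] u mu /=.
  by rewrite /alternate cats0 => _; exact: moving_act.
case/andP=> mu' mus; rewrite orb_mx_alternate !mxactM.
have [w0 w12 _] := IH u' mu' mus.
exact/moving_act/swap_act.
Qed.

Lemma alternate_lower u us : moving F u -> all (moving F) us ->
  Q (alternate u us) 1 0 != 0.
Proof.
move=> mu mus; have [] := @alternate_act u us (1, 0) mu mus.
  by rewrite /= size_poly0 size_poly1.
by rewrite /mxact /= mulr1 mulr0 addr0.
Qed.

(** Excludes that an alternating product is a multiple of t. It would send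
    (y : 0) and (y : 1) to (0 : 1) and (1 : 1), whereas the reductions of both
    images are the image of (1 : 0) under the first syllable. *)
Lemma alternate_not_swap u us : moving F u -> all (moving F) us ->
  let N := Q (alternate u us) in
  N 0 0 = 0 -> N 1 1 = 0 -> N 0 1 <> 'X * N 1 0.
Proof.
move=> mu mus N N00 N11 N01.
have small (a : P) (p : R) : (size (a%:P * p)%R < size p)%N -> a = 0.
  by have [//|a0] := eqVneq a 0; rewrite size_Cmul ?ltnn.
have [] := @alternate_act u us ('X, 0) mu mus.
  by rewrite /= size_poly0 size_polyX.
rewrite /mxact -/N /= N00 mul0r !mulr0 !addr0 mulr0 sub0r => _ _.
rewrite size_polyN => /small m00.
have [] := @alternate_act u us ('X, 1) mu mus.
  by rewrite /= size_poly1 size_polyX.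
rewrite /mxact -/N /= N00 N11 N01 m00 polyC0 !mul0r subr0 add0r addr0 mulr1.
by rewrite mulrC => _ _ /small m10; move: mu; rewrite /moving m10 eqxx.
Qed.

Lemma orb_mx_twist (D : comNzRingType) (x y : D) e :
  orb_mx x y (twist e) = if e then swap_mx y else 1.
Proof.
by case: e; rewrite /orb_mx ?big_cons big_nil ?mulr1.
Qed.

(** With a factor t at one end, the product is scalar only if the alternating
    part is a multiple of t; with none or two, only if its lower left entry
    vanishes. *)
Lemma normal_scalar (W : word (option bool)) : normal F W -> is_scalar (Q W) ->
  exists i, W = incl (cycle_word i i).
Proof.
have X0 : ('X : R) != 0 by rewrite polyX_eq0.
have XF0 : ('X : P) != 0 by rewrite polyX_eq0.
have mulX0 (p : R) : 'X * p = 0 -> p = 0.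
  by move/eqP; rewrite mulf_eq0 (negPf X0) => /eqP.
case=> [i j e|e u us e' mu mus].
  rewrite orb_mx_cat orb_mx_incl -(map_free_mx (@polyC P)) free_mx_cycle map_mx2.
  set p := _ * 'X ^+ _; set q := _ * 'X ^+ (6 * j).
  have q0 : q != 0 by rewrite mulf_neq0 ?expf_neq0 ?comm_det_neq0.
  rewrite orb_mx_twist; case: e => -[].
    rewrite swap_mulr !mx2E => _ /eqP.
    by rewrite polyC_eq0 (negPf q0).
  rewrite mulr1 !mx2E => _ _ /polyC_inj; rewrite {q0}/p {}/q => e; exists i.
  rewrite cats0; suff -> : i = j by [].
  move: e => /(mulfI (expf_neq0 _ (comm_det_neq0 F))) e.
  have := congr1 (size \o @polyseq F) e.
  by rewrite /= !size_polyXn => -[] /eqP; rewrite eqn_mul2l => /eqP.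
have q10 := alternate_lower mu mus.
have qsw := alternate_not_swap mu mus.
rewrite (orb_mx_cat _ _ (twist _)) (orb_mx_cat _ _ (alternate _ _)).
rewrite !orb_mx_twist.
set N := Q (alternate u us) in q10 qsw *.
have {}q10 : N 1 0 = 0 -> False by move=> n10; move: q10; rewrite n10 eqxx.
case: e e' => -[].
- rewrite swap_mulr swap_mull => -[]; rewrite !mx2E => /mulX0 /mulX0 n10 _ _.
  by case: (q10 n10).
- rewrite mulr1 swap_mull => -[]; rewrite !mx2E => /mulX0 N11 N00 /esym N01.
  by case: (qsw N00 N11 N01).
- rewrite mul1r swap_mulr => -[]; rewrite !mx2E => /mulX0 N00 N11 N01.
  by case: (qsw N00 N11 N01).
- by rewrite mul1r mulr1 => -[_ n10 _]; case: (q10 n10).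
Qed.
End SecondPingPong.

(** * The representation of Gamma *)

Section Orbifold.

(** The second relator t c t c says that t inverts c, since t is an
    involution. *)
Definition orbifold_relator (w : word (option bool)) : Prop :=
  w = twist true ++ twist true \/
  w = twist true ++ incl comm_word ++ twist true ++ incl comm_word.

Definition orbifold_group : groupType := presented_group orbifold_relator.

Definition orb_gen (i : option bool) : orbifold_group :=
  pg_class orbifold_relator [:: (i, true)].

Local Notation t := (orb_gen None).
Local Notation c := (word_eval (fun b => orb_gen (Some b)) comm_word).

Lemma orb_gen_swapK : (t * t = 1)%g.
Proof.
rewrite -[(t * t)%g]/(pg_mul _ _) -pg_classM; apply: pg_class_rel.
by left.
Qed.

Lemma orb_gen_swap_comm : (t * c * t = c^-1)%g.
Proof.
apply/esym/eqP; rewrite -eqg_inv invgK; apply/eqP/esym/mulg1_eq.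
have : word_eval orb_gen
    (twist true ++ incl comm_word ++ twist true ++ incl comm_word) = 1%g.
  by rewrite -pg_class_eval; apply: pg_class_rel; right.
rewrite (word_eval_cat _ (twist _)) (word_eval_cat _ (incl _)).
by rewrite (word_eval_cat _ (twist _)) twist_eval1 word_eval_incl !mulgA.
Qed.

Lemma orb_mx_relator (D : comNzRingType) (x y : D) r :
  orbifold_relator r -> exists d, orb_mx x y r = d%:M.
Proof.
case=> ->.
  exists y; rewrite orb_mx_cat !orb_mx_twist swap_mulr mx2_scalar.
  by apply: mx2P; rewrite !mx2E; ring.
exists ((comm_det x * x ^+ 3) ^+ 2 * y).
rewrite (orb_mx_cat _ _ (twist _)) (orb_mx_cat _ _ (incl _)).
rewrite (orb_mx_cat _ _ (twist _)) !orb_mx_twist orb_mx_incl.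
rewrite free_mx_comm /swap_mx mx2_scalar !mx2M.
by apply: mx2P; rewrite !mx2E; ring.
Qed.

End Orbifold.

Section Represents.
Context (K : fieldType).
Implicit Types (q : pgl 2 K) (M N : 'M[K]_2).

Definition represents q M : Prop :=
  exists2 A : gl 2 K, q = pgl_class A & val A = M.

Lemma scalar_mul_unit M N d :
  d != 0 -> M * N = d%:M -> M \in unitmx /\ N \in unitmx.
Proof.
move=> d0 MN; have [] // := @mulmx1_unit _ _ M (d^-1 *: N).
  by rewrite -scalemxAr -[M *m N]/(M * N) MN scale_scalar_mx mulVf.
by rewrite unitmxZ // unitfE invr_eq0.
Qed.

Lemma represents1 : represents 1%g 1.
Proof. by exists (gl_one 2 K). Qed.

Lemma representsM p q M N :
  represents p M -> represents q N -> represents (p * q)%g (M * N).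
Proof.
move=> [A -> <-] [B -> <-]; exists (gl_mul A B) => //.
by rewrite -[(_ * _)%g]/(pgl_mul _ _) pgl_classM.
Qed.

Lemma represents_scalar q d : represents q d%:M -> q = 1%g.
Proof.
move=> [A -> Ad]; apply/pgl_classP; exists d; last by rewrite Ad /= scalemx1.
have : val A \in unitmx := valP A.
rewrite Ad; apply: contraTneq => ->.
by rewrite unitmxE det_scalar expr0n unitr0.
Qed.

Lemma represents1_scalar M : represents 1%g M -> is_scalar M.
Proof.
move=> [A /esym/pgl_classP[d d0 Ad] <-].
by rewrite Ad scalemx1 mx2_scalar; split; rewrite !mx2E.
Qed.

Lemma representsV q M N d : d != 0 -> M * N = d%:M ->
  represents q M -> represents q^-1%g N.
Proof.
move=> d0 MN qM; have [_ NM] := scalar_mul_unit d0 MN.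
exists (GL NM) => //; apply/mulg1_eq/(@represents_scalar _ d).
by rewrite -MN; apply: representsM => //; exists (GL NM).
Qed.
End Represents.

(** Two specializations of the same matrices over [D] are compared: [f] goes to
    the field of the representation, and [g] to polynomials in y over F[x],
    where degrees are available. *)
Section Faithful.
Context (F K : fieldType) (D : comNzRingType).
Context (f : {rmorphism D -> K}) (g : {rmorphism D -> {poly {poly F}}}).
Context (f_inj : injective f) (x y : D).
Context (gx : g x = 'X%:P) (gy : g y = 'X).

Lemma eval_neq0 d : g d != 0 -> f d != 0.
Proof.
apply: contra_neq => fd0; rewrite (_ : d = 0) ?rmorph0 //.
by apply: f_inj; rewrite rmorph0.
Qed.

Lemma map_letter_det (D1 D2 : comNzRingType) (m : {rmorphism D1 -> D2}) z b :
  m (letter_det z b) = letter_det (m z) b.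
Proof. by case: b; rewrite /letter_det /= rmorphB /= !rmorphXn. Qed.

Lemma fy_neq0 : f y != 0.
Proof. by rewrite eval_neq0 // gy polyX_eq0. Qed.

Lemma letter_det_fx_neq0 b : letter_det (f x) b != 0.
Proof.
rewrite -map_letter_det eval_neq0 // map_letter_det gx.
by rewrite -(map_letter_det (@polyC _)) polyC_eq0 letter_det_neq0.
Qed.

Lemma swap_mxK (z : K) : swap_mx z * swap_mx z = z%:M.
Proof. by rewrite swap_mull mx2_scalar; apply: mx2P; rewrite !mx2E ?mulr1 ?mulr0. Qed.

Lemma gen_mx_unit i : orb_letter_mx (f x) (f y) (i, true) \in unitmx.
Proof.
case: i => [b|]; first by have [] :=
  scalar_mul_unit (letter_det_fx_neq0 b) (letter_mxV _ b true).
by have [] := scalar_mul_unit fy_neq0 (swap_mxK _).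
Qed.

Definition pgl_gen i : pgl 2 K := pgl_class (GL (gen_mx_unit i)).

Lemma pgl_gen_represents w : represents (word_eval pgl_gen w) (orb_mx (f x) (f y) w).
Proof.
elim: w => [|[i s] w IH].
  by rewrite word_eval_nil /orb_mx big_nil; exact: represents1.
rewrite word_eval_cons orb_mx_cons; apply: representsM IH.
have gi : represents (pgl_gen i) (orb_letter_mx (f x) (f y) (i, true)).
  by exists (GL (gen_mx_unit i)).
case: s => //; rewrite /letter_eval /=.
case: i gi => [b|] gi.
  exact: representsV (letter_det_fx_neq0 b) (letter_mxV _ b true) gi.
exact: representsV fy_neq0 (swap_mxK _) gi.
Qed.

Lemma pgl_gen_relator r : orbifold_relator r -> word_eval pgl_gen r = 1%g.
Proof.
move=> /(orb_mx_relator (f x) (f y))[d e].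
by apply: (@represents_scalar _ _ d); rewrite -e; exact: pgl_gen_represents.
Qed.

Definition orbifold_rep : orbifold_group -> pgl 2 K :=
  @pg_lift _ _ pgl_gen orbifold_relator.

Lemma orbifold_repM : {morph orbifold_rep : p q / (p * q)%g}.
Proof. exact: pg_lift_mul pgl_gen_relator. Qed.

(** An element of the kernel is replaced by a normal form; its matrix is scalar
    over [K], hence over [D] by injectivity of [f], hence over F[x][y], which
    leaves only the trivial normal forms. *)
Lemma orbifold_rep_inj q : orbifold_rep q = 1%g -> q = 1%g.
Proof.
rewrite -(pg_reprK q) pg_class_eval.
have [w nw <-] := normal_form F orb_gen_swapK orb_gen_swap_comm (pg_repr q).
rewrite -pg_class_eval /orbifold_rep (pg_lift_class pgl_gen_relator) => w1.
have := pgl_gen_represents w; rewrite w1 => /represents1_scalar sK.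
have sD : is_scalar (orb_mx x y w).
  move: sK; rewrite -map_orb_mx => -[]; rewrite !mxE => e01 e10 e.
  by split; apply: f_inj; rewrite ?rmorph0.
have := is_scalar_map g sD; rewrite map_orb_mx gx gy => /(normal_scalar nw)[i ->].
by rewrite pg_class_eval (word_eval_incl orb_gen) (word_eval_cycle orb_gen) mulgV.
Qed.
End Faithful.

(** * The surface group inside Gamma *)

Section Cover.
Local Open Scope group_scope.

Definition bracket (G : groupType) (x y : G) : G := x * y * x^-1 * y^-1.

Lemma surface_relator_eval (G : groupType) m (f : 'I_m + 'I_m -> G) :
  word_eval f (surface_relator m) = \prod_(i < m) bracket (f (inl i)) (f (inr i)).
Proof.
have enumE : enum 'I_m = index_enum 'I_m by rewrite enumT [index_enum _]unlock.
rewrite /word_eval big_flatten big_map enumE; apply: eq_bigr => i _.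
by rewrite !big_cons big_nil /letter_eval /= mulg1 /bracket !mulgA.
Qed.

Context (n : nat) (n_gt0 : (0 < n)%N).
Local Notation Sigma := (surface_group n.+1).
Local Notation Gamma := orbifold_group.
Local Notation a := (orb_gen (Some false)).
Local Notation b := (orb_gen (Some true)).
Local Notation t := (orb_gen None).

(** The k-th lift, in the n-fold cyclic covering, of the loop [t * z * t] of the
    second handle of the genus 2 surface. *)
Definition handle (k : nat) (z : Gamma) : Gamma := a ^+ k * (t * z * t) * a ^- k.

Definition cover_gen (i : 'I_n.+1 + 'I_n.+1) : Gamma :=
  match i with
  | inl j => if val j is k.+1 then handle k a else a ^+ n
  | inr j => if val j is k.+1 then handle k b else b
  end.

Lemma orb_gen_swapV : t^-1 = t.
Proof. exact: mulg1_eq orb_gen_swapK. Qed.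

Lemma bracket_handle k :
  bracket (handle k a) (handle k b) = a ^+ k * bracket b a * a ^- k.
Proof.
have hE z : handle k z = z ^ (t * a ^- k).
  by rewrite /handle conjgE invgM invgK orb_gen_swapV !mulgA.
have -> : bracket b a = (bracket a b) ^ t.
  have cE : word_eval (fun i => orb_gen (Some i)) comm_word = bracket a b.
    by rewrite !word_eval_cons word_eval_nil /letter_eval /= mulg1 /bracket !mulgA.
  rewrite conjgE orb_gen_swapV mulgA -cE orb_gen_swap_comm cE.
  by rewrite /bracket !invgM !invgK !mulgA.
by rewrite /bracket !hE -!conjVg -!conjMg conjgM [LHS]conjgE invgK !mulgA.
Qed.

(** The product of the conjugates a^i [b, a] a^-i over i < n telescopes to
    [b, a^n], the inverse of the bracket of the images of the first pair. *)
Lemma cover_relator : word_eval cover_gen (surface_relator n.+1) = 1.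
Proof.
rewrite surface_relator_eval big_ord_recl /=.
have e k : \prod_(i < k) (a ^+ i * bracket b a * a ^- i) = bracket b (a ^+ k).
  elim: k => [|k IH]; first by rewrite big_ord0 /bracket invg1 !mulg1 mulgV.
  rewrite big_ord_recr IH /bracket /= expgSr invgM !mulgA.
  by rewrite !mulgVK.
rewrite (eq_bigr (fun i : 'I_n => a ^+ i * bracket b a * a ^- i)); last first.
  by move=> i _; exact: bracket_handle.
rewrite e /bracket.
by rewrite !mulgA mulgVK mulgVK mulgK mulgV.
Qed.

Definition cover_map : Sigma -> Gamma :=
  @pg_lift _ _ cover_gen (fun w => w = surface_relator n.+1).

Lemma cover_mapM : {morph cover_map : p q / p * q}.
Proof. by apply: pg_lift_mul => _ ->; exact: cover_relator. Qed.

Definition surf_a k : Sigma := pg_class _ [:: (inl (inord k), true)].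
Definition surf_b k : Sigma := pg_class _ [:: (inr (inord k), true)].
Definition surf_bracket k := bracket (surf_a k) (surf_b k).

(** The action of b on the k-th sheet of the side false. On the side true, the
    commutator c acts on the sheet k by the bracket of index k + 1, so on the
    side false it must act by the inverse of that bracket; as a moves down one
    sheet, this gives the recursion. *)
Fixpoint beta k : Sigma :=
  if k is k'.+1 then (surf_bracket k)^-1 * beta k' else surf_b 0.

Lemma surface_relation : \prod_(0 <= k < n.+1) surf_bracket k = 1.
Proof.
rewrite big_mkord; pose R (w : word ('I_n.+1 + 'I_n.+1)) := w = surface_relator n.+1.
have /esym := @pg_class_eval _ R (surface_relator n.+1).
rewrite surface_relator_eval pg_class_rel // => e; rewrite -[RHS]e.
by apply: eq_bigr => i _; rewrite /surf_bracket /surf_a /surf_b inord_val.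
Qed.

Lemma betaE k : surf_b 0 = (\prod_(1 <= i < k.+1) surf_bracket i) * beta k.
Proof.
elim: k => [|k IH]; first by rewrite big_geq // mul1g.
by rewrite big_nat_recr //= -mulgA mulVKg.
Qed.

(** The same condition at the sheet where a wraps around: it is the surface
    relation that closes up the recursion. *)
Lemma beta_wrap :
  surf_a 0 * surf_b 0 * (surf_a 0)^-1 * (beta n.-1)^-1 = (surf_bracket n)^-1.
Proof.
apply: (mulIg (surf_bracket n)); rewrite mulVg -surface_relation.
rewrite big_ltn // big_nat_recr //=.
have := betaE n.-1; rewrite prednK // => e.
have -> : (beta n.-1)^-1 = (surf_b 0)^-1 * \prod_(1 <= i < n) surf_bracket i.
  by rewrite e invgM mulgVK.
have -> : surf_bracket 0 = surf_a 0 * surf_b 0 * (surf_a 0)^-1 * (surf_b 0)^-1 by [].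
by rewrite !mulgA.
Qed.

(** (side, sheet, element); t exchanges the sides and a shifts the sheets of the
    side false. *)
Definition point := (bool * nat * Sigma)%type.

Definition sgn (s : bool) (x : Sigma) : Sigma := if s then x else x^-1.

(** Sheets are natural numbers, and the action is trivial from [n] on, so that
    every letter is a bijection. *)
Definition act_letter (l : option bool * bool) (z : point) : point :=
  let: (e, i, h) := z in let s := l.2 in
  if (n <= i)%N then z else
  match l.1 with
  | None => (~~ e, i, h)
  | Some false =>
      if e then (e, i, sgn s (surf_a i.+1) * h)
      else if s then (if i is k.+1 then (e, k, h) else (e, n.-1, surf_a 0 * h))
      else if (i.+1 < n)%N then (e, i.+1, h) else (e, 0%N, (surf_a 0)^-1 * h)
  | Some true => (e, i, sgn s (if e then surf_b i.+1 else beta i) * h)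
  end.

Definition act (w : word (option bool)) (z : point) : point :=
  foldr act_letter z w.

Lemma act_cat u v z : act (u ++ v) z = act u (act v z).
Proof. exact: foldr_cat. Qed.

Lemma act_letterK o s z : act_letter (o, s) (act_letter (o, ~~ s) z) = z.
Proof.
case: z => [[e i] h] /=; have [ni|ni] := leqP n i; first by rewrite /= ni.
have sgnK x y : sgn s x * (sgn (~~ s) x * y) = y.
  by case: s; rewrite /sgn /= ?mulKg ?mulVKg.
case: o => [[]|] /=.
- by rewrite leqNgt ni /= sgnK.
- case: e => /=; first by rewrite leqNgt ni /= sgnK.
  case: s {sgnK} => /=.
    case: ltnP => i1 /=; first by rewrite leqNgt i1.
    by rewrite leqNgt n_gt0 /= mulVKg; congr (_, _, _); lia.
  case: i ni => [|k] /= ni; last by rewrite leqNgt (ltnW ni) /= ni.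
  by rewrite leqNgt prednK // leqnn /= ltnn mulKg.
- by rewrite leqNgt ni negbK.
Qed.

Lemma act_comm e i h : (i < n)%N ->
  act (incl comm_word) (e, i, h) =
  (e, i, (if e then surf_bracket i.+1 else (surf_bracket i.+1)^-1) * h).
Proof.
move=> ni; rewrite /= leqNgt ni /=.
case: e => /=.
  by (do 3! rewrite (leqNgt n i) ni /=); rewrite /sgn /surf_bracket /bracket !mulgA.
rewrite (leqNgt n i) ni /=.
case: ltnP => i1 /=.
  by (do 2! rewrite (leqNgt n i.+1) i1 /=); rewrite -!mulgA mulVKg.
rewrite leqNgt n_gt0 /= leqNgt n_gt0 /= /sgn.
have -> : i = n.-1 by lia.
by rewrite prednK // -beta_wrap !mulgA.
Qed.

Lemma act_relator r z : orbifold_relator r -> act r z = z.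
Proof.
case: z => [[e i] h]; have [ni|ni] := leqP n i.
  have fix_out l : act_letter l (e, i, h) = (e, i, h) by rewrite /= ni.
  by move=> _; elim: r => //= l r ->.
have act_t e' h' : act (twist true) (e', i, h') = (~~ e', i, h').
  by rewrite /= leqNgt ni.
case=> ->; rewrite !act_cat; first by rewrite !act_t negbK.
rewrite act_comm // act_t act_comm // act_t negbK.
by case: e; rewrite /= ?mulKg ?mulVKg.
Qed.

Lemma act_word_eq u v z : word_eq orbifold_relator u v -> act u z = act v z.
Proof.
move=> uv; elim: uv z => {u v} [//|u v _ uv z|v u w _ uv _ vw z|u o s v z|u r v Rr z].
- by rewrite uv.
- by rewrite uv.
- by rewrite !act_cat /= act_letterK.
- by rewrite !act_cat (act_relator _ Rr).
Qed.

Definition gact (q : Gamma) (z : point) : point := act (pg_repr q) z.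

Lemma gact_class w z : gact (pg_class orbifold_relator w) z = act w z.
Proof. exact/act_word_eq/pg_repr_class. Qed.

Lemma gactM p q z : gact (p * q) z = gact p (gact q z).
Proof.
rewrite -(pg_reprK p) -(pg_reprK q) -[_ * _]/(pg_mul _ _) -pg_classM.
by rewrite !gact_class act_cat.
Qed.

Lemma gact1 z : gact 1 z = z.
Proof. exact: (gact_class [::]). Qed.

Lemma gact_inv q z z' : gact q z = z' -> gact q^-1 z' = z.
Proof. by move=> <-; rewrite -gactM mulVg gact1. Qed.

Lemma gact_gen o z : gact (orb_gen o) z = act_letter (o, true) z.
Proof. exact: gact_class. Qed.

Lemma gact_descend k i h : (k + i < n)%N ->
  gact (a ^+ k) (false, k + i, h)%N = (false, i, h).
Proof.
elim: k => [|k IH] kin; first by rewrite gact1.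
rewrite expgSr gactM gact_gen /= leqNgt kin /= IH //.
exact: ltnW.
Qed.

Lemma gact_descend0 k h : (k < n)%N ->
  gact (a ^+ k) (false, k, h) = (false, 0%N, h).
Proof. by have := @gact_descend k 0 h; rewrite addn0. Qed.

Lemma gact_swap e k h : (k < n)%N -> gact t (e, k, h) = (~~ e, k, h).
Proof. by move=> kn; rewrite gact_gen /= leqNgt kn. Qed.

Lemma gact_cover_gen i h :
  gact (cover_gen i) (false, 0%N, h) = (false, 0%N, pg_class _ [:: (i, true)] * h).
Proof.
have gact_handle k z x : (k < n)%N ->
    (forall h, gact z (true, k, h) = (true, k, x * h)) ->
    gact (handle k z) (false, 0%N, h) = (false, 0%N, x * h).
  move=> kn zx; rewrite /handle !gactM (gact_inv (gact_descend0 _ kn)).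
  by rewrite gact_swap // zx gact_swap //; exact: gact_descend0.
case: i => j; rewrite /cover_gen /= -{2}(inord_val j); have := ltn_ord j;
  case: (nat_of_ord j) => [|k] jn.
- have -> : a ^+ n = a ^+ n.-1 * a by rewrite -expgSr prednK.
  rewrite gactM gact_gen /= leqNgt n_gt0 /=.
  by apply: gact_descend0; rewrite prednK.
- by apply: gact_handle => // h'; rewrite gact_gen /= leqNgt (jn : (k < n)%N).
- by rewrite gact_gen /= leqNgt n_gt0.
- by apply: gact_handle => // h'; rewrite gact_gen /= leqNgt (jn : (k < n)%N).
Qed.

(** The image of [w] acts on the base copy of Sigma_g by left multiplication by
    [w], which recovers [w] from its image. *)
Lemma gact_cover w h : gact (word_eval cover_gen w) (false, 0%N, h) =
  (false, 0%N, pg_class (fun w => w = surface_relator n.+1) w * h).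
Proof.
rewrite pg_class_eval; elim: w h => [|[i s] w IH] h.
  by rewrite !word_eval_nil gact1 mul1g.
rewrite !word_eval_cons gactM IH -mulgA; case: s; first exact: gact_cover_gen.
by apply: gact_inv; rewrite gact_cover_gen mulVKg.
Qed.

Lemma cover_map_inj q : cover_map q = 1 -> q = 1.
Proof.
rewrite -(pg_reprK q) /cover_map pg_lift_class; last first.
  by move=> _ ->; exact: cover_relator.
by move=> e; have := gact_cover (pg_repr q) 1; rewrite e gact1 mulg1 => -[].
Qed.

End Cover.

Lemma multiplicative_inj (G H : groupType) (m : G -> H) :
  {morph m : x y / (x * y)%g} -> (forall x, m x = 1%g -> x = 1%g) ->
  exists rho : {multiplicative G -> H}, injective rho.
Proof.
move=> mM m1; pose M := isMultiplicative.Build G H m mM.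
pose rho : {multiplicative G -> H} := HB.pack m M.
exists rho; move=> u v uv; apply/divg1_eq/m1.
by apply: (mulIg (m v)); rewrite -mM mulgVK mul1g.
Qed.

Lemma surface_group_rep (F : fieldType) n : (0 < n)%N ->
  exists rho : {multiplicative surface_group n.+1 -> pgl 2 {fraction {mpoly F[2]}}},
    injective rho.
Proof.
move=> n_gt0; pose D := {mpoly F[2]}.
(* The specialization to iterated polynomials: X_0 is x and X_1 is y. *)
pose c : {rmorphism F -> {poly {poly F}}} := polyC \o polyC.
pose e : {rmorphism D -> {poly {poly F}}} :=
  mmap c (fun i : 'I_2 => if i == 0 then 'X%:P else 'X).
have ex : e 'X_0 = 'X%:P by rewrite /e /= mmapX mmap1U.
have ey : e 'X_1 = 'X by rewrite /e /= mmapX mmap1U.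
pose f : {rmorphism D -> {fraction D}} := @FracField.tofrac {mpoly F[2]}.
have f_inj : injective f by move=> u v /eqP; rewrite tofrac_eq => /eqP.
apply: (@multiplicative_inj _ _
  (fun q => orbifold_rep f_inj ex ey (cover_map q))) => [u v|q].
  by rewrite cover_mapM orbifold_repM.
by move/orbifold_rep_inj/cover_map_inj; apply.
Qed.

Local Close Scope ring_scope.

Theorem theorem4 (p g : nat) :
  prime p -> 5 <= p -> 2 <= g ->
  exists (K : fieldExtType {fraction {mpoly 'F_p[2]}})
         (rho : {multiplicative surface_group g -> pgl 2 K}),
    injective rho.
Proof.
move=> _ _; case: g => [//|n] n_gt0.
exists ({fraction {mpoly 'F_p[2]}}^o)%R.
exact: surface_group_rep.
Qed.
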